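(* Every multiple conjugation quandle $X$ has a unique maximal connected sub-multiple conjugation quandle decomposition; that is, there is exactly one decomposition $X=\bigsqcup_{i\in I}A_i$ (as a disjoint union, up to re-indexing) in which every $A_i$ is a maximal connected sub-multiple conjugation quandle of $X$.
   Context: A multiple conjugation quandle (MCQ) is a disjoint union $X=\bigsqcup_{\lambda\in\Lambda}G_\lambda$ of groups $G_\lambda$ with a binary operation $*:X\times X\to X$ such that: (i) $a*b=b^{-1}ab$ for $a,b\in G_\lambda$; (ii) $x*e_\lambda=x$ and $x*(ab)=(x*a)*b$ for $x\in X$, $a,b\in G_\lambda$, where $e_\lambda$ is the identity of $G_\lambda$; (iii) $(x*y)*z=(x*z)*(y*z)$ for $x,y,z\in X$; (iv) for $x\in X$ and $a,b\in G_\lambda$, the elements $a*x,b*x$ lie in a common $G_\mu$ and $(ab)*x=(a*x)(b*x)$. A sub-multiple conjugation quandle of $X$ is a non-empty subset $Y$ that is itself an MCQ under $*$ and the group operations of $X$. An automorphism of $X$ is a bijection $\phi:X\to X$ with $\phi(x*y)=\phi(x)*\phi(y)$ for all $x,y \in X$ and $\phi(ab)=\phi(a)\phi(b)$ whenever $a,b$ lie in the same $G_\lambda$. For $a\in X$, $S_a(x)=x*a$ is an automorphism of $X$; $\mathrm{Inn}(X)$ is the group of automorphisms generated by $\{S_a\mid a\in X\}$. It acts on the index set $\Lambda$ by $e_{\lambda\cdot g}=g(e_\lambda)$. $X$ is connected if this action on $\Lambda$ is transitive. A sub-MCQ of $X$ is connected if it is connected as an MCQ in its own right (with its own index set and its own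 inner automorphism group). A connected sub-MCQ $A$ of $X$ is a maximal connected sub-multiple conjugation quandle of $X$ if the only connected sub-MCQ of $X$ including $A$ is $A$ itself. $X=\bigsqcup_{i\in I}A_i$ is called the maximal connected sub-multiple conjugation quandle decomposition of $X$ when each $A_i$ is a maximal connected sub-multiple conjugation quandle of $X$. *)

(* Defs.v *)
From HB Require Import structures.
From mathcomp Require Import all_boot.
From mathcomp Require Import boolp classical_sets.

Set Implicit Arguments.
Unset Strict Implicit.
Unset Printing Implicit Defensive.

Local Open Scope classical_set_scope.
Local Open Scope group_scope.

Definition elt (I : Type) (G : I -> groupType) (i : I) (a : G i) : {i & G i} :=
  existT (fun i => G i) i a.
Arguments elt {I G} i a.

(* The disjoint union of the groups is a sigma type, so that "a and b lie in
   a common group" means that they come from two elements of one [block i].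
   The choice structure contained in [groupType] is no restriction, since
   [boolp] equips every type with one. *)
Record mcq := Mcq {
  mcq_index : Type;
  block : mcq_index -> groupType;
  op : {i & block i} -> {i & block i} -> {i & block i};
  op_conj : forall i (a b : block i),
    op (elt i a) (elt i b) = elt i (b^-1 * a * b);
  op_one : forall x i, op x (elt i 1) = x;
  op_mulr : forall x i (a b : block i),
    op x (elt i (a * b)) = op (op x (elt i a)) (elt i b);
  op_dist : forall x y z, op (op x y) z = op (op x z) (op y z);
  op_mull : forall x i (a b : block i), exists j (a' b' : block j),
    [/\ op (elt i a) x = elt j a', op (elt i b) x = elt j b' &
        op (elt i (a * b)) x = elt j (a' * b')] }.

Definition carrier (X : mcq) : Type := {i & @block X i}.
Coercion carrier : mcq >-> Sortclass.

Notation "x <* y" := (@op _ x y) (at level 50, left associativity).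

Definition automorphism (X : mcq) (f : X -> X) : Prop :=
  [/\ bijective f,
      forall x y : X, f (x <* y) = f x <* f y &
      forall i (a b : block i), exists j (a' b' : @block X j),
        [/\ f (elt i a) = elt j a', f (elt i b) = elt j b' &
            f (elt i (a * b)) = elt j (a' * b')] ].

(* Membership in Inn(X), the group generated by the maps S_a. *)
Inductive inner (X : mcq) : (X -> X) -> Prop :=
| inner_S (a : X) : inner (fun x : X => x <* a)
| inner_id : inner (fun x : X => x)
| inner_comp (f g : X -> X) : inner f -> inner g -> inner (fun x => f (g x))
| inner_inv (f g : X -> X) : inner f -> cancel f g -> cancel g f -> inner g.

(* Transitivity of the action of Inn(X) on the index set, where i . g is the
   index j such that g e_i = e_j. *)
Definition mcq_connected (X : mcq) : Prop :=
  forall i j : mcq_index X,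
    exists2 g : X -> X, inner g & g (elt i 1) = elt j 1.

Section InnerAutomorphisms.
Variable X : mcq.

Lemma elt_inj (i : mcq_index X) : injective (@elt _ (@block X) i).
Proof. by move=> a b /(@existT_inj2 {classic (mcq_index X)} (@block X)). Qed.

Lemma elt_index (i j : mcq_index X) (a : block i) (b : block j) :
  elt i a = elt j b -> i = j.
Proof. exact: existT_inj1. Qed.

Lemma automorphism_one (f : X -> X) (i : mcq_index X) :
  automorphism f -> exists j, f (elt i 1) = elt j 1.
Proof.
case=> _ _ /(_ i 1 1)[j [a [b [fa fb]]]].
rewrite mulg1 => fab; exists j; rewrite [LHS]fa; congr elt.
have /elt_inj ab := etrans (esym fa) fb.
have /elt_inj := etrans (esym fa) fab; rewrite -ab => aa.
by apply: (mulgI a); rewrite mulg1.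
Qed.

Lemma automorphism_S (a : X) : automorphism (fun x : X => x <* a).
Proof.
split=> [|x y|i b c]; last 2 first.
- exact: op_dist.
- exact: op_mull.
case: a => i a; exists (fun x : X => x <* elt i a^-1) => x.
  by rewrite -[existT _ _ _]/(elt i a) -op_mulr mulgV op_one.
by rewrite -[existT _ _ _]/(elt i a) -op_mulr mulVg op_one.
Qed.

Lemma inner_automorphism (f : X -> X) : inner f -> automorphism f.
Proof.
elim=> {f} [a||f g _ [fbij fop fmul] _ [gbij gop gmul]|f g _ fA fK gK].
- exact: automorphism_S.
- by split=> [|//|i a b]; [exists id | exists i, a, b].
- split=> [|x y|i a b]; first exact: bij_comp.
    by rewrite gop fop.
  have [j [a' [b' [-> -> ->]]]] := gmul i a b.
  exact: fmul.
have [fbij fop fmul] := fA.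
split=> [|x y|i a b]; first by exists f.
  by apply: (bij_inj fbij); rewrite fop !gK.
have index_g (c : block i) j (c' : @block X j) :
    g (elt i c) = elt j c' -> f (elt j 1) = elt i 1.
  move=> gc; have [k fj1] := automorphism_one j fA.
  have fc : f (elt j c') = elt i c by rewrite -gc gK.
  have := fmul j c' 1; rewrite mulg1 => -[l [u [v [uE vE _]]]].
  have il := elt_index (etrans (esym fc) uE).
  have kl := elt_index (etrans (esym fj1) vE).
  by rewrite [LHS]fj1 kl il.
case ga : (g (elt i a)) => [j a']; case gb : (g (elt i b)) => [k b'].
have jk : j = k.
  apply: (@elt_index _ _ 1 1); apply: (bij_inj fbij).
  exact: etrans (index_g _ _ _ ga) (esym (index_g _ _ _ gb)).
case: k / jk in b' gb *.
exists j, a', b'; split=> //; apply: (bij_inj fbij); rewrite gK.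
have [l [u [v [uE vE uvE]]]] := fmul j a' b'.
have fa : f (elt j a') = elt i a by rewrite -[RHS]gK ga.
have fb : f (elt j b') = elt i b by rewrite -[RHS]gK gb.
have il := elt_index (etrans (esym fa) uE).
case: l / il in u v uE vE uvE *.
have /elt_inj -> := etrans (esym fa) uE.
have /elt_inj -> := etrans (esym fb) vE.
by rewrite [RHS]uvE.
Qed.

End InnerAutomorphisms.

(* A non-empty subset that is closed under the operation, and whose
   non-empty intersections with the groups of X are subgroups. *)
Record sub_mcq (X : mcq) (A : set X) : Prop := SubMcq {
  sub_mcq_neq0 : A !=set0;
  sub_mcq_op : forall x y, A x -> A y -> A (x <* y);
  sub_mcq_mul : forall i (a b : @block X i),
    A (elt i a) -> A (elt i b) -> A (elt i (a * b));
  sub_mcq_inv : forall i (a : @block X i), A (elt i a) -> A (elt i a^-1) }.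

Section SubMcq.
Variables (X : mcq) (A : set X) (HA : sub_mcq A).

Definition slice (i : mcq_index X) : set (block i) := [set a | A (elt i a)].
Arguments slice : clear implicits.

Definition sub_index : Type := [set i : mcq_index X | slice i !=set0].

Definition sub_block of sub_mcq A := fun i : sub_index =>
  set_type (slice (sval i)).

Section Group.
Variable i : sub_index.

HB.instance Definition _ := SubChoice.on (sub_block HA i).

Lemma slice_group_closed : group_closed (mem (slice (sval i))).
Proof.
have inv (a : block (sval i)) : A (elt _ a) -> A (elt _ a^-1).
  exact: sub_mcq_inv.
split=> [|a b]; last first.
  by rewrite !inE => Aa Ab; apply: sub_mcq_mul => //; apply: inv.
have /set_mem[a Aa] := svalP i; rewrite inE /slice /= -(mulgV a).
by apply: sub_mcq_mul => //; apply: inv.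
Qed.

HB.instance Definition _ := SubChoice_isSubGroup.Build
  _ _ (sub_block HA i) slice_group_closed.

End Group.

Definition sub_incl (x : {i : sub_index & sub_block HA i}) : X :=
  elt (sval (projT1 x)) (val (projT2 x)).

Lemma sub_incl_in x : A (sub_incl x).
Proof. by have /set_mem := valP (projT2 x). Qed.

Lemma sub_incl_inj : injective sub_incl.
Proof.
case=> [[i Ai] [a Aa]] [[j Aj] [b Ab]]; rewrite /sub_incl /= => ab.
have ij := elt_index ab; case: j / ij => /= in Aj b Ab ab *.
rewrite (bool_irrelevance Aj Ai) in Ab *.
have ba := elt_inj ab; rewrite /= in ba; case: b / ba in Ab ab *.
by rewrite (bool_irrelevance Ab Aa).
Qed.

Definition sub_elt (x : X) (Ax : A x) : {i : sub_index & sub_block HA i}.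
Proof.
case: x Ax => i a Ax.
exists (exist _ i (mem_set (ex_intro _ a Ax : slice i !=set0))).
exact: (exist _ a (mem_set (Ax : slice i a))).
Defined.

Lemma sub_eltK (x : X) (Ax : A x) : sub_incl (sub_elt Ax) = x.
Proof. by case: x Ax. Qed.

Definition sub_op (x y : {i : sub_index & sub_block HA i}) :=
  sub_elt (sub_mcq_op HA (sub_incl_in x) (sub_incl_in y)).

Lemma sub_inclE x y : sub_incl (sub_op x y) = sub_incl x <* sub_incl y.
Proof. exact: sub_eltK. Qed.

Lemma sub_op_conj i (a b : sub_block HA i) :
  sub_op (elt i a) (elt i b) = elt i (b^-1 * a * b).
Proof. by apply: sub_incl_inj; rewrite sub_inclE [LHS]op_conj. Qed.

Lemma sub_op_one x (i : sub_index) : sub_op x (elt i (1 : sub_block HA i)) = x.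
Proof. by apply: sub_incl_inj; rewrite sub_inclE [LHS]op_one. Qed.

Lemma sub_op_mulr x i (a b : sub_block HA i) :
  sub_op x (elt i (a * b)) = sub_op (sub_op x (elt i a)) (elt i b).
Proof. by apply: sub_incl_inj; rewrite !sub_inclE [LHS]op_mulr. Qed.

Lemma sub_op_dist x y z :
  sub_op (sub_op x y) z = sub_op (sub_op x z) (sub_op y z).
Proof. by apply: sub_incl_inj; rewrite !sub_inclE [LHS]op_dist. Qed.

Lemma sub_op_mull x i (a b : sub_block HA i) :
  exists j (a' b' : sub_block HA j),
    [/\ sub_op (elt i a) x = elt j a', sub_op (elt i b) x = elt j b' &
        sub_op (elt i (a * b)) x = elt j (a' * b')].
Proof.
have [j [a' [b' [aE bE abE]]]] := op_mull (sub_incl x) (val a) (val b).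
have Aa : A (elt j a').
  by rewrite -aE; apply: sub_mcq_op (sub_incl_in (elt i a)) (sub_incl_in x).
have Ab : A (elt j b').
  by rewrite -bE; apply: sub_mcq_op (sub_incl_in (elt i b)) (sub_incl_in x).
pose j' : sub_index := exist _ j (mem_set (ex_intro _ a' Aa : slice j !=set0)).
exists j', (exist _ a' (mem_set (Aa : slice j a'))).
exists (exist _ b' (mem_set (Ab : slice j b'))).
by split; apply: sub_incl_inj; rewrite sub_inclE.
Qed.

(* A as a multiple conjugation quandle in its own right, indexed by the
   groups of X that meet A. *)
Definition mcq_of_sub : mcq :=
  Mcq sub_op_conj sub_op_one sub_op_mulr sub_op_dist sub_op_mull.

End SubMcq.

Definition connected_sub (X : mcq) (A : set X) : Prop :=
  exists HA : sub_mcq A, mcq_connected (mcq_of_sub HA).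

Definition maximal_connected_sub (X : mcq) (A : set X) : Prop :=
  connected_sub A /\ forall B, connected_sub B -> A `<=` B -> B = A.

Definition maximal_connected_decomposition (X : mcq) (I : Type)
    (A : I -> set X) : Prop :=
  [/\ \bigcup_i A i = setT, trivIset setT A &
      forall i, maximal_connected_sub (A i)].

(* Main.v *)
Require Import Defs.
From mathcomp Require Import all_boot.
From mathcomp Require Import boolp classical_sets.

(** Every group of X is a connected sub-MCQ, and the sub-MCQ generated by any
    family of connected sub-MCQs with a common element is again connected: the
    operation x * y moves the index of x by the inner automorphism S_y, while
    the group operations do not change the index, so every index reached during
    the generation stays in the orbit of the common one. Hence each x has a
    largest connected sub-MCQ containing it. These largest sub-MCQs are exactly
    the maximal ones, and two that meet coincide. *)

Set Implicit Arguments.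
Unset Strict Implicit.
Unset Printing Implicit Defensive.

Local Open Scope classical_set_scope.
Local Open Scope group_scope.

Section Components.
Variable X : mcq.
Implicit Types (x y z : X) (A B S : set X).

(** Encodes the index of [x] inside [X], so that the action on indices becomes the operation
    itself. *)
Definition unit_of x : X := elt (projT1 x) 1.

(** [S_y] keeps [x] and its identity in a common group, and automorphisms send identities to
    identities. *)
Lemma unit_of_op x y : unit_of (x <* y) = unit_of x <* y.
Proof.
case: x => i a; have [j [a' [b' [aE bE _]]]] := op_mull y a 1.
have [k kE] := automorphism_one i (automorphism_S y).
rewrite /unit_of -/(elt i a) aE /= [RHS]kE.
by rewrite (elt_index (etrans (esym bE) kE)).
Qed.

Lemma op_invK x i (a : block i) : x <* elt i a <* elt i a^-1 = x.
Proof. by rewrite -op_mulr mulgV op_one. Qed.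

(* For a sub-MCQ A this is the Inn(A)-orbit relation, since the inverse of S_a
   is S_(a^-1). *)
Inductive reach A x : X -> Prop :=
| reach_refl : reach A x x
| reach_op y z : reach A x y -> A z -> reach A x (y <* z).

Lemma reach_trans A y x z : reach A x y -> reach A y z -> reach A x z.
Proof. by move=> xy; elim=> // u v _ xu Av; apply: reach_op. Qed.

Lemma reach_sym A x y : sub_mcq A -> reach A x y -> reach A y x.
Proof.
move=> HA; elim=> [|u [i a] _ ux Aa]; first exact: reach_refl.
apply: reach_trans ux; rewrite -[X in reach _ _ X](op_invK u a).
by apply: reach_op; [apply: reach_refl | apply: (sub_mcq_inv HA)].
Qed.

Lemma reach_sub A B x y : A `<=` B -> reach A x y -> reach B x y.
Proof.
move=> AB; elim=> [|u v _ xu Av]; first exact: reach_refl.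
by apply: reach_op => //; apply: AB.
Qed.

Lemma inner_reach A (HA : sub_mcq A) (g : mcq_of_sub HA -> mcq_of_sub HA) :
  inner g -> forall u, reach A (sub_incl u) (sub_incl (g u)).
Proof.
elim=> {g} [a u||f g _ fR _ gR u|f g _ fR _ gK u].
- by rewrite sub_inclE; apply: reach_op (sub_incl_in a); apply: reach_refl.
- by move=> u; apply: reach_refl.
- exact: reach_trans (gR u) (fR _).
(* The path for [f] from [g u] to [f (g u) = u], reversed. *)
- by apply: reach_sym => //; rewrite -{2}(gK u); apply: fR.
Qed.

(** The witness composes the maps [S_z] along the path. *)
Lemma reach_inner A (HA : sub_mcq A) x y : reach A x y ->
  exists2 g : mcq_of_sub HA -> mcq_of_sub HA,
    inner g & forall u, sub_incl u = x -> sub_incl (g u) = y.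
Proof.
elim=> [|v z _ [g gI gP] Az]; first by exists id => //; apply: inner_id.
exists (fun u => @op (mcq_of_sub HA) (g u) (sub_elt HA Az)).
  exact: (inner_comp (inner_S (sub_elt HA Az : mcq_of_sub HA)) gI).
by move=> u /gP gu; rewrite sub_inclE gu sub_eltK.
Qed.

(** Moves connectedness from the sigma type of [mcq_of_sub HA] back to [X]: [sub_incl] preserves
    identities, and [reach] describes the orbits. *)
Lemma connected_subP A : connected_sub A <->
  sub_mcq A /\ forall x y, A x -> A y -> reach A (unit_of x) (unit_of y).
Proof.
split=> [[HA cA]|[HA rA]].
  split=> // x y Ax Ay.
  rewrite -(sub_eltK HA Ax) -(sub_eltK HA Ay).
  move: (sub_elt HA Ax) (sub_elt HA Ay) => u v.
  have [g gI gE] := cA (projT1 u) (projT1 v).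
  by have := inner_reach gI (elt (projT1 u) 1); rewrite gE.
exists HA => i j.
have [g gI gP] := reach_inner HA
  (rA _ _ (sub_incl_in (elt i 1)) (sub_incl_in (elt j 1))).
by exists g => //; apply: sub_incl_inj; apply: gP.
Qed.

Lemma connected_block (i : mcq_index X) :
  connected_sub [set x : X | projT1 x = i].
Proof.
apply/connected_subP; split; last first.
  by move=> x y /= xi yi; rewrite /unit_of xi yi; apply: reach_refl.
split=> //; first by exists (elt i 1).
case=> j a [k b] /= ji ki; move: b; rewrite ki -ji => b.
by rewrite [_ <* _]op_conj.
Qed.

Inductive generated S : set X :=
| gen_in x : S x -> generated S x
| gen_op x y : generated S x -> generated S y -> generated S (x <* y)
| gen_mul i (a b : block i) : generated S (elt i a) ->
    generated S (elt i b) -> generated S (elt i (a * b))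
| gen_inv i (a : block i) : generated S (elt i a) -> generated S (elt i a^-1).

Lemma sub_mcq_generated S : S !=set0 -> sub_mcq (generated S).
Proof.
case=> x Sx; split; first by exists x; apply: gen_in.
- exact: gen_op.
- exact: gen_mul.
- exact: gen_inv.
Qed.

Definition component x : set X :=
  generated [set y | exists A, [/\ connected_sub A, A x & A y]].

Lemma connected_sub_component A x :
  connected_sub A -> A x -> A `<=` component x.
Proof. by move=> cA Ax y Ay; apply: gen_in; exists A. Qed.

Lemma component_refl x : component x x.
Proof. by apply: (connected_sub_component (connected_block (projT1 x))). Qed.

Lemma connected_component x : connected_sub (component x).
Proof.
have HC : sub_mcq (component x).
  apply: sub_mcq_generated; exists x, [set y | projT1 y = projT1 x].
  by split=> //; apply: connected_block.
suff from_x y : component x y -> reach (component x) (unit_of x) (unit_of y).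
  apply/connected_subP; split=> // y z /from_x xy /from_x xz.
  exact: reach_trans (reach_sym HC xy) xz.
(* The product and inverse cases close at once, since [unit_of] depends only on the index. *)
elim=> // [{}y [A [cA Ax Ay]]|u v _ xu Cv _].
  have /connected_subP[_ rA] := cA.
  exact: reach_sub (connected_sub_component cA Ax) (rA _ _ Ax Ay).
by rewrite unit_of_op; apply: reach_op.
Qed.

Lemma maximal_componentE A x :
  maximal_connected_sub A -> A x -> A = component x.
Proof.
case=> cA maxA Ax; apply/esym/maxA; first exact: connected_component.
exact: connected_sub_component.
Qed.

(** A connected [B] above [component x] contains [x], so it is among the generators of
    [component x]. *)
Lemma maximal_component x : maximal_connected_sub (component x).
Proof.
split=> [|B cB CB]; first exact: connected_component.
apply/seteqP; split=> //; apply: connected_sub_component => //.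
exact/CB/component_refl.
Qed.

Lemma maximal_neq0 A : maximal_connected_sub A -> A !=set0.
Proof. by case=> [[HA _] _]; apply: sub_mcq_neq0 HA. Qed.

Lemma maximal_eq A B x : maximal_connected_sub A -> maximal_connected_sub B ->
  A x -> B x -> A = B.
Proof.
move=> mA mB Ax Bx; rewrite (maximal_componentE mA Ax).
exact/esym/maximal_componentE.
Qed.

End Components.

Theorem theorem4 (X : mcq) :
  exists (I : Type) (A : I -> set X),
    maximal_connected_decomposition A /\
    (forall (J : Type) (B : J -> set X), maximal_connected_decomposition B ->
       exists f : J -> I, bijective f /\ (forall j : J, B j = A (f j))).
Proof.
(* Indexing by the maximal sub-MCQs themselves makes [B] its own re-indexing map. *)
exists {A : set X | maximal_connected_sub A}, sval; split.
  split=> [||[]//].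
    apply/seteqP; split=> // x _.
    exists (exist _ _ (maximal_component x)) => //.
    exact: component_refl.
  move=> [A mA] [B mB] _ _ /= [x [Ax Bx]].
  exact/eq_exist/(maximal_eq mA mB Ax Bx).
move=> J B [Bcover Bdisj Bmax].
(* A point of [M] lies in some [B j] by the covering, and maximal sub-MCQs that meet are equal. *)
have inv (M : {A : set X | maximal_connected_sub A}) : {j | B j = sval M}.
  apply: cid; case: M => M mM; have [x Mx] := maximal_neq0 mM.
  have [j _ Bx] : (\bigcup_j B j) x by rewrite Bcover.
  by exists j; apply: maximal_eq Bx Mx.
exists (fun j => exist _ (B j) (Bmax j)); split=> //.
exists (fun M => sval (inv M)) => [j|M]; last first.
  by case: (inv M) => j /= BM; case: M BM => M mM /= BM; apply: eq_exist.
(* [B k = B j] is non-empty, so disjointness forces [k = j]. *)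
case: (inv _) => k /= Bkj; have [x Bx] := maximal_neq0 (Bmax j).
by apply: Bdisj => //; exists x; split=> //; rewrite Bkj.
Qed.
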